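(* Let $\mathsf L$ be any of the propositional team logics $\mathbf{CPL},\mathbf{CPL}^+,\mathbf{PI},\mathbf{PI}^+,\mathbf{PT},\mathbf{PT}^+,\mathbf{PU},\mathbf{PU}^+,\mathbf{PInc},\mathbf{PInc}^+,\mathbf{PD},\mathbf{PD}^+,\mathbf{FPT}$. For any set $\Gamma\cup\{\phi\}$ of formulas of $\mathsf L$, if $\Gamma\models\phi$, then there is a finite $\Gamma_0\subseteq\Gamma$ with $\Gamma_0\models\phi$.
   Context: Variables $p_i$ ($i\in\mathbb N$); a valuation is $s:\mathbb N\to\{0,1\}$; a team is a set of valuations; $s(\vec i)=\langle s(i_1),\dots,s(i_k)\rangle$. Team semantics: $X\models p_i$ iff $s(i)=1$ for all $s\in X$; $X\models\neg p_i$ iff $s(i)=0$ for all $s\in X$; $X\models\bot$ iff $X=\emptyset$; $X\models\mathrm{NE}$ iff $X\neq\emptyset$; $X\models p_{\vec i}\perp p_{\vec j}$ iff for all $s,s'\in X$ some $s''\in X$ has $s''(\vec i)=s(\vec i)$, $s''(\vec j)=s'(\vec j)$; $X\models{=}(p_{i_1},\dots,p_{i_k},p_j)$ iff for all $s,s'\in X$, $s(\vec i)=s'(\vec i)$ implies $s(j)=s'(j)$; $X\models p_{\vec i}\subseteq p_{\vec j}$ (sequences of equal length) iff for all $s\in X$ some $s'\in X$ has $s(\vec i)=s'(\vec j)$; $\wedge$ as usual; $X\models\phi\otimes\psi$ iff $X=Y\cup Z$ with $Y\models\phi$, $Z\models\psi$; $X\models\phi\circledast\psi$ iff $X=\emptyset$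 or $X=Y\cup Z$ with $Y,Z$ nonempty, $Y\models\phi$, $Z\models\psi$; $X\models\phi\vee\psi$ iff $X\models\phi$ or $X\models\psi$; $X\models\phi\multimap\psi$ iff for every team $Y$ with $Y\models\phi$, $X\cup Y\models\psi$. $\Gamma\models\phi$ means every team satisfying all formulas of $\Gamma$ satisfies $\phi$. Logics (atoms; connectives): $\mathbf{CPL}$: $p_i,\neg p_i,\bot$; $\wedge,\otimes$. $\mathbf{CPL}^+$: adds atom $\mathrm{NE}$. $\mathbf{PI}$: $p_i,\neg p_i,\bot$, independence atoms; $\wedge,\otimes$. $\mathbf{PI}^+$: adds $\mathrm{NE}$. $\mathbf{PT}$: $p_i,\neg p_i,\bot$; $\wedge,\circledast,\vee$. $\mathbf{PT}^+$: $p_i,\neg p_i,\bot,\mathrm{NE}$; $\wedge,\otimes,\vee$. $\mathbf{PU}$: $p_i,\neg p_i,\bot$; $\wedge,\otimes,\circledast$. $\mathbf{PU}^+$: adds $\mathrm{NE}$. $\mathbf{PInc}$: $p_i,\neg p_i,\bot$, inclusion atoms; $\wedge,\otimes$. $\mathbf{PInc}^+$: adds $\mathrm{NE}$. $\mathbf{PD}$: $p_i,\neg p_i,\bot$, dependence atoms; $\wedge,\otimes,\vee$. $\mathbf{PD}^+$: same atoms; $\wedge,\otimes,\vee,\multimap$. $\mathbf{FPT}$: all of $p_i,\neg p_i,\bot,\mathrm{NE}$, independence, dependence, inclusion atoms; $\wedge,\otimes,\circledast,\vee$. *)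

(* Defs.v *)
From mathcomp Require Import all_boot.
From mathcomp Require Import boolp classical_sets cardinality.

Set Implicit Arguments.
Unset Strict Implicit.
Unset Printing Implicit Defensive.

Local Open Scope classical_set_scope.

Definition valuation := nat -> bool.

Definition team := set valuation.

(* One grammar containing every atom and connective; the individual logics are
   carved out of it by [formulas] below. Sequences of variables may be empty;
   in particular [Dep [::] j] is the constancy atom =(p_j). *)
Inductive formula : Type :=
  | Var of nat
  | NegVar of nat
  | Bot
  | NE
  | Indep of seq nat & seq nat
  | Dep of seq nat & nat
  | Incl (k : nat) of k.-tuple nat & k.-tuple nat
  | And of formula & formula
  | Tensor of formula & formula
  | NETensor of formula & formula  (* the connective \circledast *)
  | Or of formula & formula
  | Lolli of formula & formula.

Fixpoint sat (X : team) (f : formula) : Prop :=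
  match f with
  | Var i => forall s, X s -> s i = true
  | NegVar i => forall s, X s -> s i = false
  | Bot => X = set0
  | NE => X !=set0
  | Indep vi vj => forall s s', X s -> X s' ->
      exists s'', [/\ X s'', map s'' vi = map s vi & map s'' vj = map s' vj]
  | Dep vi j => forall s s', X s -> X s' -> map s vi = map s' vi -> s j = s' j
  | Incl _ vi vj => forall s, X s -> exists s', X s' /\ map s vi = map s' vj
  | And f g => sat X f /\ sat X g
  | Tensor f g => exists Y Z : team, [/\ X = Y `|` Z, sat Y f & sat Z g]
  | NETensor f g => X = set0 \/
      exists Y Z : team,
        [/\ X = Y `|` Z, Y !=set0, Z !=set0, sat Y f & sat Z g]
  | Or f g => sat X f \/ sat X g
  | Lolli f g => forall Y : team, sat Y f -> sat (X `|` Y) g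
  end.

Definition entails (Gamma : set formula) (f : formula) : Prop :=
  forall X : team, (forall g, Gamma g -> sat X g) -> sat X f.

Variant logic :=
  | CPL | CPLplus | PI | PIplus | PT | PTplus | PU | PUplus
  | PInc | PIncplus | PD | PDplus | FPT.

(* The optional symbols: p_i, ~p_i, bottom and conjunction belong to every
   logic and need no tag. *)
Variant symbol :=
  | sNE | sIndep | sDep | sIncl | sTensor | sNETensor | sOr | sLolli.

Definition symbols (L : logic) : set symbol :=
  match L with
  | CPL => [set sTensor]
  | CPLplus => [set sNE; sTensor]
  | PI => [set sIndep; sTensor]
  | PIplus => [set sNE; sIndep; sTensor]
  | PT => [set sNETensor; sOr]
  | PTplus => [set sNE; sTensor; sOr]
  | PU => [set sTensor; sNETensor]
  | PUplus => [set sNE; sTensor; sNETensor]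
  | PInc => [set sIncl; sTensor]
  | PIncplus => [set sNE; sIncl; sTensor]
  | PD => [set sDep; sTensor; sOr]
  | PDplus => [set sDep; sTensor; sOr; sLolli]
  | FPT => [set sNE; sIndep; sDep; sIncl; sTensor; sNETensor; sOr]
  end.

Fixpoint formulas (L : logic) (f : formula) : Prop :=
  match f with
  | Var _ | NegVar _ | Bot => True
  | NE => symbols L sNE
  | Indep _ _ => symbols L sIndep
  | Dep _ _ => symbols L sDep
  | Incl _ _ _ => symbols L sIncl
  | And f g => formulas L f /\ formulas L g
  | Tensor f g => [/\ symbols L sTensor, formulas L f & formulas L g]
  | NETensor f g => [/\ symbols L sNETensor, formulas L f & formulas L g]
  | Or f g => [/\ symbols L sOr, formulas L f & formulas L g]
  | Lolli f g => [/\ symbols L sLolli, formulas L f & formulas L g]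
  end.

(* Main.v *)
Require Import Defs.
From mathcomp Require Import all_boot.
From mathcomp Require Import boolp classical_sets cardinality filter.

(** Satisfaction is local, for every connective including the linear
    implication: a formula only sees the finitely many variables occurring in
    it. If no finite part of Gamma entails phi, then some ultrafilter U on the
    set of all teams contains every [set X | sat X g], g in Gamma, and
    [set X | ~ sat X phi]. Let X* consist of the valuations all of whose finite
    restrictions occur in U-almost every team. There are only finitely many
    restrictions to the first n variables, and (by a König argument) every such
    restriction occurring U-almost everywhere extends to an element of X*; so
    U-almost every team agrees with X* on the first n variables, and by locality
    X* satisfies Gamma but not phi. *)

Set Implicit Arguments.
Unset Strict Implicit.
Unset Printing Implicit Defensive.

Local Open Scope classical_set_scope.

Definition agree (n : nat) (s t : valuation) := forall i, i < n -> s i = t i.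

Lemma agree_sym n s t : agree n s t -> agree n t s.
Proof. by move=> st i /st. Qed.

Lemma agree_trans n s t u : agree n s t -> agree n t u -> agree n s u.
Proof. by move=> st tu i lt_in; rewrite st ?tu. Qed.

Lemma agree_leq m n s t : m <= n -> agree n s t -> agree m s t.
Proof. by move=> le_mn st i /leq_trans/(_ le_mn)/st. Qed.

Definition team_sub (n : nat) (X Y : team) :=
  forall s, X s -> exists2 t, Y t & agree n s t.

(** Equality of the restrictions of [X] and [Y] to the first [n] variables, with both teams kept as
    sets of full valuations. *)
Definition team_agree (n : nat) (X Y : team) := team_sub n X Y /\ team_sub n Y X.

Lemma team_agree_sym n X Y : team_agree n X Y -> team_agree n Y X.
Proof. by case. Qed.

Lemma team_agree_set0 n Y : team_agree n set0 Y -> Y = set0.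
Proof. by case=> _ sYX; apply/seteqP; split=> // s /sYX[]. Qed.

Lemma team_agree_nonempty n X Y : team_agree n X Y -> X !=set0 -> Y !=set0.
Proof. by move=> [sXY _] [s /sXY[t Yt _]]; exists t. Qed.

Lemma team_agreeUr n X X' Y :
  team_agree n X X' -> team_agree n (X `|` Y) (X' `|` Y).
Proof.
move=> [sXX' sX'X]; split=> s [Xs|Ys]; try by exists s => //; right.
- by have [t X't st] := sXX' s Xs; exists t => //; left.
- by have [t Xt st] := sX'X s Xs; exists t => //; left.
Qed.

(** Transfers the decompositions used by both tensors: each part becomes the set of members of [X]
    that agree with some element of it. *)
Lemma team_agree_split n X Y Z :
    team_agree n (Y `|` Z) X ->
  exists Y' Z', [/\ X = Y' `|` Z', team_agree n Y Y' & team_agree n Z Z'].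
Proof.
move=> [sYZX sXYZ].
have part (W : team) : W `<=` Y `|` Z ->
    team_agree n W [set s | X s /\ exists2 t, W t & agree n s t].
  move=> sW; split=> [s Ws|s [_ [t Wt st]]]; last by exists t.
  have [t Xt st] := sYZX s (sW s Ws); exists t => //.
  by split=> //; exists s => //; apply: agree_sym.
exists [set s | X s /\ exists2 t, Y t & agree n s t].
exists [set s | X s /\ exists2 t, Z t & agree n s t].
split; [|exact: part|exact: part].
apply/seteqP; split=> [s Xs|s [[]|[]]//].
by have [t [Wt|Wt] st] := sXYZ s Xs; [left|right]; split=> //; exists t.
Qed.

Definition seq_bound (v : seq nat) := \max_(i <- v) i.+1.

Lemma map_agree n v s t :
  seq_bound v <= n -> agree n s t -> map s v = map t v.
Proof.
move=> le_vn st; apply/eq_in_map => i iv; apply: st.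
by apply: leq_trans le_vn; rewrite /seq_bound; apply: leq_bigmax_seq.
Qed.

Fixpoint var_bound (f : formula) : nat :=
  match f with
  | Var i | NegVar i => i.+1
  | Bot | NE => 0
  | Indep vi vj => maxn (seq_bound vi) (seq_bound vj)
  | Dep vi j => maxn (seq_bound vi) j.+1
  | Incl _ vi vj => maxn (seq_bound vi) (seq_bound vj)
  | And f g | Tensor f g | NETensor f g | Or f g | Lolli f g =>
      maxn (var_bound f) (var_bound g)
  end.

Lemma sat_local n f X Y :
  var_bound f <= n -> team_agree n X Y -> sat X f -> sat Y f.
Proof.
elim: f X Y => [i|i|||vi vj|vi j|k vi vj|f IHf g IHg|f IHf g IHg|f IHf g IHg
  |f IHf g IHg|f IHf g IHg] X Y /=; rewrite ?geq_max.
- by move=> le_in [_ sYX] Xi s /sYX[t Xt ->//]; apply: Xi.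
- by move=> le_in [_ sYX] Xi s /sYX[t Xt ->//]; apply: Xi.
- by move=> _ XY X0; move: XY; rewrite X0 => /team_agree_set0.
- by move=> _ /team_agree_nonempty.
- move=> /andP[le_i le_j] [sXY sYX] Xij s s' /sYX[t Xt st] /sYX[t' Xt' st'].
  have [u [Xu ut ut']] := Xij _ _ Xt Xt'; have [v Yv uv] := sXY _ Xu.
  exists v; rewrite -(map_agree le_i uv) -(map_agree le_j uv) ut ut'.
  by rewrite (map_agree le_i st) (map_agree le_j st').
- move=> /andP[le_i le_j] [_ sYX] Xij s s' /sYX[t Xt st] /sYX[t' Xt' st'].
  rewrite (map_agree le_i st) (map_agree le_i st') st// st'//.
  exact: Xij.
- move=> /andP[le_i le_j] [sXY sYX] Xij s /sYX[t Xt st].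
  have [u [Xu tu]] := Xij _ Xt; have [v Yv uv] := sXY _ Xu.
  by exists v; rewrite -(map_agree le_j uv) -tu (map_agree le_i st).
- by move=> /andP[le_f le_g] XY [/(IHf _ _ le_f XY) ? /(IHg _ _ le_g XY)].
- move=> /andP[le_f le_g] XY [A [B [XE Af Bg]]].
  move: XY; rewrite XE => /team_agree_split[A' [B' [-> AA' BB']]].
  by exists A', B'; split=> //; [exact: IHf Af|exact: IHg Bg].
- move=> /andP[le_f le_g] XY [X0|[A [B [XE A0 B0 Af Bg]]]].
    by left; move: XY; rewrite X0 => /team_agree_set0.
  right; move: XY; rewrite XE => /team_agree_split[A' [B' [-> AA' BB']]].
  exists A', B'; split=> //.
  + exact: team_agree_nonempty AA' A0.
  + exact: team_agree_nonempty BB' B0.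
  + exact: IHf Af.
  + exact: IHg Bg.
- move=> /andP[le_f le_g] XY [Xf|Xg]; [left|right].
    exact: IHf Xf.
  exact: IHg Xg.
(* The added team [Z] is the same on both sides, so it is enough that the unions agree. *)
- move=> /andP[le_f le_g] XY Xfg Z /Xfg; apply: IHg => //.
  exact: team_agreeUr.
Qed.

(** König argument: one-step extensions are iterated by choice, and their diagonal is a single
    valuation through all levels. *)
Lemma valuation_extension (P : nat -> valuation -> Prop) n s :
    (forall m t t', agree m t t' -> P m t -> P m t') ->
    (forall m t, P m t -> exists2 t', P m.+1 t' & agree m t t') ->
    P n s ->
  exists2 t, agree n s t & forall m, n <= m -> P m t.
Proof.
move=> Pagree Pext Pns.
have /choice[next nextP] (x : nat * valuation) : exists t',
    P x.1 x.2 -> P x.1.+1 t' /\ agree x.1 x.2 t'.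
  have [/Pext[t' ? ?]|nP] := pselect (P x.1 x.2); first by exists t'.
  (* A default value where [P] fails. *)
  by exists x.2.
pose v := fix v k := if k is k'.+1 then next (n + k', v k') else s.
have Pv k : P (n + k) (v k).
  elim: k => [|k IHk]; first by rewrite addn0.
  by rewrite addnS; have [] := nextP (n + k, v k) IHk.
have vS k : agree (n + k) (v k) (v k.+1).
  by have [] := nextP (n + k, v k) (Pv k).
have vD k l : agree (n + k) (v k) (v (k + l)).
  elim: l => [|l IHl]; first by rewrite addn0.
  apply: agree_trans IHl _; rewrite addnS.
  by apply: agree_leq (vS (k + l)); rewrite leq_add2l leq_addr.
(* The value at [i] is settled from stage [i.+1] on, since [i < n + i.+1]; stage [i] would be too
   early when [n = 0]. *)
have vt k : agree (n + k) (v k) (fun i => v i.+1 i).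
  move=> i lt_i; case: (leqP k i.+1) => [le_k|/ltnW le_k].
    by rewrite -(subnKC le_k); apply: vD.
  rewrite -(subnKC le_k); symmetry; apply: vD.
  by rewrite addnS ltnS leq_addl.
exists (fun i => v i.+1 i) => [i lt_in|m le_nm].
  by apply: (vt 0); rewrite addn0.
by rewrite -(subnKC le_nm); apply: Pagree (Pv _).
Qed.

Definition occurs (n : nat) (s : valuation) : set team :=
  [set X | exists2 t, X t & agree n s t].

Lemma occurs_agree n s t : agree n s t -> occurs n s `<=` occurs n t.
Proof.
move=> st X [u Xu su]; exists u => //.
by apply: agree_trans su; apply: agree_sym.
Qed.

Definition limit_team (U : set_system team) : team :=
  [set s | forall n, U (occurs n s)].

Section LimitTeam.
Variables (U : set_system team) (UU : UltraFilter U).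

Let upd (s : valuation) (n : nat) (b : bool) : valuation :=
  fun i => if i == n then b else s i.

Let agree_upd s n b : agree n s (upd s n b).
Proof. by move=> i lt_in; rewrite /upd ltn_eqF. Qed.

(** The ultrafilter decides whether the extension by [true] occurs; if not, a witness for [s] must
    take the value [false] at [n]. *)
Lemma ultra_occursS n s :
  U (occurs n s) -> exists2 t, U (occurs n.+1 t) & agree n s t.
Proof.
move=> Us; have [Ut|Ut] := in_ultra_setVsetC (occurs n.+1 (upd s n true)) UU.
  by exists (upd s n true).
exists (upd s n false) => //.
apply: filterS (filterI Us Ut) => X [[t Xt st] nX].
have agreeS : agree n.+1 (upd s n (t n)) t.
  move=> i; rewrite ltnS leq_eqVlt /upd => /predU1P[->|lt_in].
    by rewrite eqxx.
  by rewrite ltn_eqF// st.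
case tn: (t n) agreeS => agreeS; last by exists t.
by case: nX; exists t.
Qed.

Lemma limit_team_occurs n s : U (occurs n s) -> occurs n s (limit_team U).
Proof.
move=> Us.
have [||t st Ut] :=
  @valuation_extension (fun m t => U (occurs m t)) n s _ _ Us.
- by move=> m t t' tt'; apply: filterS; apply: occurs_agree.
- exact: ultra_occursS.
(* Levels below [n] are inherited from level [n] by restriction. *)
exists t => // m; case: (leqP n m) => [|/ltnW le_mn]; first exact: Ut.
apply: filterS (Ut n (leqnn n)) => X [u Xu tu]; exists u => //.
exact: agree_leq tu.
Qed.

Lemma limit_team_agree n : U [set X | team_agree n X (limit_team U)].
Proof.
pose val (r : {ffun 'I_n -> bool}) : valuation :=
  fun i => if insub i is Some j then r j else false.
have valP s : agree n s (val [ffun i : 'I_n => s i]).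
  by move=> i lt_in; rewrite /val insubT ffunE.
have : U [set X | forall r,
    occurs n (val r) X <-> occurs n (val r) (limit_team U)].
  (* A finite intersection: [r] ranges over a finite type. *)
  apply: filter_forall => r.
  have [Ur|Ur] := in_ultra_setVsetC (occurs n (val r)) UU.
    apply: filterS (Ur) => X Xr; split=> // _.
    exact: limit_team_occurs.
  (* A member of the limit team with restriction [r] would put two disjoint sets in [U]. *)
  apply: filterS (Ur) => X nXr; split=> // -[t Lt rt]; exfalso.
  apply: (filter_not_empty U).
  have Ut := occurs_agree (agree_sym rt).
  by apply: filterS (filterI (Lt n) Ur) => Y [/Ut].
apply: filterS => X XL; split=> s Ws.
- have /XL[t Lt st] : occurs n (val [ffun i : 'I_n => s i]) X.
    by exists s => //; apply: agree_sym.
  by exists t => //; apply: agree_trans st.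
- have /XL[t Lt st] : occurs n (val [ffun i : 'I_n => s i]) (limit_team U).
    by exists s => //; apply: agree_sym.
  by exists t => //; apply: agree_trans st.
Qed.

(** Two sets of [U] meet, so some team both satisfies [f] and agrees with the limit team on the
    variables of [f]. *)
Lemma sat_limit_team f : U [set X | sat X f] -> sat (limit_team U) f.
Proof.
move=> Uf.
have [X [Xf]] := filter_ex (filterI Uf (limit_team_agree (var_bound f))).
by move=> /sat_local; apply.
Qed.

Lemma nsat_limit_team f : U [set X | ~ sat X f] -> ~ sat (limit_team U) f.
Proof.
move=> Uf Lf.
have [X [Xf]] := filter_ex (filterI Uf (limit_team_agree (var_bound f))).
by move=> /team_agree_sym/sat_local XL; apply: Xf; apply: XL.
Qed.

End LimitTeam.

Definition countermodels (Gamma : set formula) (phi : formula) : set team :=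
  [set X | (forall g, Gamma g -> sat X g) /\ ~ sat X phi].

Lemma entailsPn Gamma phi :
  ~ entails Gamma phi -> countermodels Gamma phi !=set0.
Proof.
move=> /existsNP[X /not_implyP[XG Xphi]].
by exists X.
Qed.

Lemma compactness Gamma phi :
    entails Gamma phi ->
  exists Gamma0, [/\ finite_set Gamma0, Gamma0 `<=` Gamma & entails Gamma0 phi].
Proof.
move=> hent; apply: contrapT => nfin.
(* The countermodel sets of finite parts of [Gamma] form a filter base: unions of parts give
   intersections, and properness is the assumed failure of compactness. *)
pose F : set_system team := [set A | exists Gamma0,
  [/\ finite_set Gamma0, Gamma0 `<=` Gamma & countermodels Gamma0 phi `<=` A]].
have FF : ProperFilter F.
  split.
    move=> [G0 [finG0 sG0 G0phi]]; apply: nfin; exists G0; split=> //.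
    by apply: contrapT => /entailsPn[X /G0phi].
  split.
  - by exists set0; split.
  - move=> A B [G1 [fin1 sG1 G1A]] [G2 [fin2 sG2 G2B]].
    exists (G1 `|` G2); split; first by rewrite finite_setU.
      by rewrite subUset.
    move=> X [XG Xphi]; split; [apply: G1A|apply: G2B]; split=> // g Gg.
      by apply: XG; left.
    by apply: XG; right.
  - move=> A B AB [G0 [finG0 sG0 G0A]]; exists G0; split=> //.
    exact: subset_trans AB.
have [U [UU FU]] := ultraFilterLemma FF.
have Uphi : U [set X | ~ sat X phi].
  by apply: FU; exists set0; split=> // X [].
apply: (nsat_limit_team UU Uphi); apply: hent => g Gg.
apply: sat_limit_team; apply: FU; exists [set g]; split=> [||X [Xg _]].
- exact: finite_set1.
- by move=> _ ->.
- exact: Xg.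
Qed.

(** All the logics are fragments of one grammar and share the relation [entails], so a single
    compactness argument covers them. *)
Theorem theorem4p1 (L : logic) (Gamma : set formula) (phi : formula)
    (hGamma : Gamma `<=` formulas L) (hphi : formulas L phi)
    (hent : entails Gamma phi) :
  exists Gamma0 : set formula,
    [/\ finite_set Gamma0, Gamma0 `<=` Gamma & entails Gamma0 phi].
Proof. exact: compactness. Qed.
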